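(* Let $Z$ be a $\Sigma$-product of completely metrizable spaces, and suppose that $Z$ is crowded. Then the hyperspace $\mathcal{S}_c(\mathcal{A}(Z))$ of nontrivial convergent sequences of the Alexandroff duplicate $\mathcal{A}(Z)$ of $Z$ is a Baire space.
   Context: $\Sigma$-product: given a family $(X_i)_{i\in I}$ of spaces and a point $a=(a_i)_{i\in I}\in\prod_{i\in I}X_i$, the $\Sigma$-product of the $X_i$ based at $a$ is the subspace $\{x\in\prod_{i\in I}X_i: |\{i\in I: x_i\neq a_i\}|\le\omega\}$ of the product. A space is crowded if it has no isolated points. The Alexandroff duplicate of a space $Y$ is $\mathcal{A}(Y)=Y\times\{0,1\}$ in which every point $(y,1)$ is isolated and the basic neighborhoods of $(y,0)$ are the sets $(U\times\{0,1\})\setminus\{(y,1)\}$ with $U$ an open neighborhood of $y$ in $Y$. For a Tychonoff space $X$, a nontrivial convergent sequence of $X$ is a subset $S\subseteq X$ such that $|S|=\omega$, $S$ (as a subspace) has a unique non-isolated point, denoted $x_S$, and $|S\setminus U|<\omega$ for each neighborhood $U$ of $x_S$. Let $\mathcal{CL}(X)$ be the set of all nonempty closed subsets of $X$, with the Vietoris topology: a base consists of the sets $\langle \mathcal{U}\rangle=\{F\in\mathcal{CL}(X): F\subseteq\bigcup\mathcal{U}\text{ and }F\cap U\neq\emptyset\text{ for all }U\in\mathcal{U}\}$, where $\mathcal{U}$ runs over nonempty finite families of nonempty open subsets of $X$. Let $\mathcal{S}_c(X)=\{S\in\mathcal{CL}(X): S\text{ is a nontrivial convergent sequence of }X\}$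 with the subspace topology. A space is Baire (has the Baire property) if every countable intersection of dense open subsets is dense. *)

(* Defs.v *)
From HB Require Import structures.
From mathcomp Require Import all_boot all_order all_algebra.
From mathcomp Require Import all_classical all_reals all_analysis.

Set Implicit Arguments.
Unset Strict Implicit.
Unset Printing Implicit Defensive.

Import Order.TTheory GRing.Theory Num.Theory.
Local Open Scope classical_set_scope.
Local Open Scope card_scope.
Local Open Scope ring_scope.

Definition metric_on (R : realType) (T : Type) (d : T -> T -> R) : Prop :=
  [/\ forall x y, d x y = 0 <-> x = y,
      forall x y, d x y = d y x &
      forall x y z, d x z <= d x y + d y z].

Definition metric_induces_topology (R : realType) (T : topologicalType)
    (d : T -> T -> R) : Prop :=
  forall x : T,
    nbhs x = filter_from [set e : R | 0 < e] (fun e => [set y | d x y < e]).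

Definition complete_metric (R : realType) (T : topologicalType)
    (d : T -> T -> R) : Prop :=
  forall u : nat -> T,
    (forall e : R, 0 < e -> exists N : nat, forall m n : nat,
       (N <= m)%N -> (N <= n)%N -> d (u m) (u n) < e) ->
    exists l : T, u @ \oo --> l.

Definition completely_metrizable (R : realType) (T : topologicalType) : Prop :=
  exists d : T -> T -> R,
    [/\ metric_on d, metric_induces_topology d & complete_metric d].

(* Coerced to a type, this set carries the subspace topology inherited from
   the product [prod_topology X]. *)
Definition sigma_product (I : Type) (X : I -> topologicalType)
    (a : forall i, X i) : set (prod_topology X) :=
  [set x | countable [set i | x i <> a i]].

Definition crowded (T : topologicalType) : Prop := isolated [set: T] = set0.

Definition baire_space (T : topologicalType) : Prop :=
  forall F : (set T)^nat,
    (forall n, open (F n) /\ dense (F n)) -> dense (\bigcap_n F n).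

(* [(y, false)] and [(y, true)] encode (y,0) and (y,1). The type is kept distinct
   from [Y * bool], which carries the product topology. *)
Definition alexandroff_duplicate (Y : Type) : Type := (Y * bool)%type.

Section alexandroff_duplicate_topology.
Context {Y : topologicalType}.
Local Notation AD := (alexandroff_duplicate Y).

HB.instance Definition _ := Choice.on AD.

Definition duplicate_basic (y : Y) (U : set Y) : set AD :=
  (U `*` [set: bool]) `\ (y, true).

(* The sets [duplicate_basic y U] are open themselves, hence form a neighbourhood
   base at [(y, false)], as soon as points are closed in [Y]: see
   [nbhs_duplicate0]. *)
Definition duplicate_open (A : set AD) : Prop :=
  forall y : Y, A (y, false) ->
    exists2 U : set Y, open_nbhs y U & duplicate_basic y U `<=` A.

Let duplicate_openT : duplicate_open [set: AD].
Proof. by move=> y _; exists setT => //; split => //; exact: openT. Qed.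

Let duplicate_openI : setI_closed duplicate_open.
Proof.
move=> A B oA oB y [/oA[U [oU Uy] UA] /oB[V [oV Vy] VB]].
exists (U `&` V); first by split => //; exact: openI.
by move=> p [[[Up Vp] _] py]; split; [exact: UA|exact: VB].
Qed.

Let duplicate_open_bigcup (I : Type) (f : I -> set AD) :
  (forall i, duplicate_open (f i)) -> duplicate_open (\bigcup_i f i).
Proof.
move=> of_ y [i _ /of_[U yU Uf]].
by exists U => // p /Uf fp; exists i.
Qed.

HB.instance Definition _ := isOpenTopological.Build AD
  duplicate_openT duplicate_openI duplicate_open_bigcup.

Lemma nbhs_duplicate1 (y : Y) :
  nbhs ((y, true) : AD) = [set A | A (y, true)].
Proof.
apply/seteqP; split=> A; first exact: nbhs_singleton.
move=> Ay; rewrite nbhsE; exists [set (y, true) : AD]; last by move=> _ ->.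
by split.
Qed.

Lemma nbhs_duplicate0 (y : Y) : accessible_space Y ->
  nbhs ((y, false) : AD) = filter_from (open_nbhs y) (duplicate_basic y).
Proof.
move=> /accessible_closed_set1 Y1; apply/seteqP; split=> A.
  by rewrite nbhsE => -[B [oB /oB[U yU UB]] BA]; exists U => // p /UB/BA.
move=> [U [oU Uy] UA]; rewrite nbhsE; exists (duplicate_basic y U) => //.
split; last by split => // -[].
move=> z [[/= Uz _] _]; have [->|zy] := pselect (z = y); first by exists U.
exists (U `\ y); first by split => //; rewrite setDE; apply: openI => //; exact/closed_openC/Y1.
by move=> [w b] [[[Uw wy] _] _]; split => //= -[].
Qed.

End alexandroff_duplicate_topology.

Definition CL (T : topologicalType) : Type :=
  set_type [set F : set T | closed F /\ F !=set0].

Section vietoris_topology.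
Context {T : topologicalType}.

HB.instance Definition _ := Choice.on (CL T).

Definition vietoris_index : set (set (set T)) :=
  [set U | [/\ finite_set U, U !=set0 & forall u, U u -> open u /\ u !=set0]].

Definition vietoris_base (U : set (set T)) : set (CL T) :=
  [set F | val F `<=` \bigcup_(u in U) u /\
           forall u, U u -> val F `&` u !=set0].

Let vietoris_cover : \bigcup_(U in vietoris_index) vietoris_base U = setT.
Proof.
apply/seteqP; split=> // F _; have [_ [x Fx]] := set_valP F.
exists [set setT].
  split; [exact: finite_set1|by exists setT|].
  by move=> _ ->; split; [exact: openT|exists x].
split=> [y _|_ ->]; last by exists x.
by exists setT.
Qed.

Let vietoris_join (U V : set (set T)) (F : CL T) :
  vietoris_index U -> vietoris_index V -> vietoris_base U F ->
  vietoris_base V F ->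
  exists W, [/\ vietoris_index W, vietoris_base W F &
                vietoris_base W `<=` vietoris_base U `&` vietoris_base V].
Proof.
move=> [fU [u0 Uu0] oU] [fV [v0 Vv0] oV] [FU FmU] [FV FmV].
pose A := \bigcup_(u in U) u; pose B := \bigcup_(v in V) v.
have oA : open A by apply: bigcup_open => u /oU[].
have oB : open B by apply: bigcup_open => v /oV[].
pose W := [set u `&` B | u in U] `|` [set A `&` v | v in V].
have FmW w : W w -> val F `&` w !=set0.
  case=> -[s Ss <-].
    by have [x [Fx sx]] := FmU _ Ss; exists x; split => //; split => //; exact: FV.
  by have [x [Fx sx]] := FmV _ Ss; exists x; split => //; split => //; exact: FU.
exists W; split.
- split; first by rewrite finite_setU; split; exact: finite_image.
    by exists (u0 `&` B); left; exists u0.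
  move=> w Ww; split; last by have [x [_ wx]] := FmW _ Ww; exists x.
  case: Ww => -[s Ss <-]; apply: openI => //; first by case: (oU _ Ss).
  by case: (oV _ Ss).
- split=> // x Fx; have [u Uu ux] := FU _ Fx.
  by exists (u `&` B); [left; exists u|split => //; exact: FV].
- move=> G [GW GmW]; split; split.
  + by move=> x /GW[_ [] [s Ss <-] [sx ?]] //; exists s.
  + move=> u Uu; have [|x [Gx [ux _]]] := GmW (u `&` B); last by exists x.
    by left; exists u.
  + by move=> x /GW[_ [] [s Ss <-] [? sx]] //; exists s.
  + move=> v Vv; have [|x [Gx [_ vx]]] := GmW (A `&` v); last by exists x.
    by right; exists v.
Qed.

HB.instance Definition _ := isBaseTopological.Build (CL T)
  vietoris_cover vietoris_join.

End vietoris_topology.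

Definition nontrivial_convergent_sequence (T : topologicalType) (S : set T) :
    Prop :=
  S #= [set: nat] /\
  exists xS : T, S `\` isolated S = [set xS] /\
    forall U : set T, nbhs xS U -> finite_set (S `\` U).

(* Coerced to a type, this set carries the subspace topology inherited from the
   Vietoris topology of [CL T]. *)
Definition Sc (T : topologicalType) : set (CL T) :=
  [set S | nontrivial_convergent_sequence (val S)].

Arguments Sc : clear implicits.

(* Main.v *)
Require Import Defs.
From HB Require Import structures.
From mathcomp Require Import all_boot all_order all_algebra.
From mathcomp Require Import all_classical all_reals all_analysis.
From mathcomp Require Import lra.

(** Let [Z] be the Sigma-product and [AD] its Alexandroff duplicate. Two kinds of
    points live in [AD]: the isolated ones [(z, true)], and the points
    [(y, false)], which are the only possible limits of a nontrivial convergent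
    sequence.

    Since [Z] is crowded, every nonempty open set of [AD] contains isolated
    points. Hence inside any nonempty open set of sequences there is a set of a
    very simple form, a _block_: all the sequences [S] such that
    [F * {1} <= S <= F * {1} u B], where [F] is a finite subset of [Z], [B] is the
    basic neighbourhood of a point [(y, false)] given by an open [U] around [y],
    and [(y, false)] is the limit of at least one sequence ([block_refine]).
    Indeed, pick a sequence in the open set and a Vietoris neighbourhood of it,
    let [F] consist of one isolated point in each of the finitely many open sets
    defining that neighbourhood, and shrink [U] around the limit.

    Given dense open sets [D n], one builds decreasing blocks with data [F n],
    [y n], [U n], the block number [n + 1] lying in [D n], and looks for a
    sequence in all of them. The candidate is the union of the [F n * {1}]
    together with [(l, false)], for a suitable point [l] common to the [U n].
    For [m > n], the points of [F m] that are not in [F n] belong to [U n], so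
    everything would follow if the [U n] formed a neighbourhood base at [l].
    In an uncountable product this is in general impossible, and the
    Sigma-product comes to the rescue. Take [U n] to be a box of radius [e n]
    on a finite set [J n] of coordinates, with [e n --> 0] and [J n] increasing. On the countable
    set of the coordinates in some [J n], the centres [y n] are Cauchy and the
    [U n] shrink to their limit; this defines [l] there, and the other
    coordinates of [l] are those of the base point [a]. As each point of each
    [F n] differs from [a] on countably many coordinates only, a bookkeeping
    argument ([stage_extension]) ensures that all these coordinates are
    eventually put into some [J n]. Then, outside the union of the [J n], the
    points of the [F n] agree with [a], hence with [l], and the candidate does
    converge ([stage_limit]). *)

Set Implicit Arguments.
Unset Strict Implicit.
Unset Printing Implicit Defensive.

Import Order.TTheory GRing.Theory Num.Theory.
Local Open Scope classical_set_scope.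
Local Open Scope card_scope.
Local Open Scope ring_scope.

(** * Nontrivial convergent sequences of a Hausdorff space *)

Section converging_sets.
Context {T : topologicalType}.
Implicit Types (x : T) (S : set T).

(** In a Hausdorff space, this is being a nontrivial convergent sequence with
    limit [x]. Closedness and the description of the isolated points are then
    automatic, which leaves only conditions that are stable under the surgery
    performed on sequences below. *)
Definition converging x S : Prop :=
  [/\ S x, countable S, infinite_set S &
      forall U, nbhs x U -> finite_set (S `\` U)].

Lemma converging_closed x S :
  hausdorff_space T -> converging x S -> closed S.
Proof.
move=> hT [Sx _ _ Scvg]; rewrite -[S]setCK; apply: open_closedC.
rewrite openE => z nSz; have zx : z != x by apply: contra_not_neq nSz => ->.
move: (hT); rewrite open_hausdorff => /(_ _ _ zx)[[A B] /= [Az Bx] [oA oB AB0]].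
have finD : finite_set (S `\` B).
  by apply: Scvg; apply: open_nbhs_nbhs; split; [|exact/set_mem].
have cD : closed (S `\` B).
  exact: (accessible_finite_set_closed.1 (hausdorff_accessible hT)).
have : nbhs z (A `&` ~` (S `\` B)).
  apply: open_nbhs_nbhs; split; first by apply: openI => //; exact: closed_openC.
  by split; [exact/set_mem|case].
apply: filterS => w [Aw nSBw] Sw; apply: nSBw; split=> // Bw.
by have : (A `&` B) w by []; rewrite (eqP AB0).
Qed.

Lemma converging_nontrivial x S :
  hausdorff_space T -> converging x S -> nontrivial_convergent_sequence S.
Proof.
move=> hT [Sx cS iS Scvg]; have aT := hausdorff_accessible hT.
split; first exact: eq_card_nat.
exists x; split=> //; apply/seteqP; split=> [z [Sz nisoz]|_ ->].
  apply: contra_notP nisoz => /eqP zx; split; first exact/mem_set.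
  move: (hT); rewrite open_hausdorff => /(_ _ _ zx)[[A B] /= [Az Bx] [oA oB AB0]].
  have finD : finite_set ((S `\` B) `\ z).
    apply/finite_setD/Scvg; apply: open_nbhs_nbhs.
    by split; [|exact/set_mem].
  exists (A `&` ~` ((S `\` B) `\ z)).
    apply: open_nbhs_nbhs; split.
      apply: openI => //; apply: closed_openC.
      exact: (accessible_finite_set_closed.1 aT).
    by split; [exact/set_mem|case=> _; apply].
  apply/seteqP; split=> [w [[Aw nw] Sw]|_ ->].
    apply: contra_notP nw => wz; split=> //; split=> // Bw.
    by have : (A `&` B) w by []; rewrite (eqP AB0).
  by split=> //; split; [exact/set_mem|case=> _; apply].
split=> // -[_ [V Vx VS]]; apply: iS.
apply: (@sub_finite_set _ _ ((S `\` V) `|` [set x])).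
  by move=> z Sz; have [Vz|nVz] := pselect (V z); [right; rewrite -VS|left].
by rewrite finite_setU; split; [exact: Scvg|exact: finite_set1].
Qed.

Lemma nontrivial_converging S :
  nontrivial_convergent_sequence S -> exists x, converging x S.
Proof.
move=> [cS [x [Sx Scvg]]]; exists x; split=> //.
- by have : [set x] x by []; rewrite -Sx => -[].
- by move: cS; rewrite card_eq_le => /andP[].
- by apply/infiniteP; move: cS; rewrite card_eq_le => /andP[].
Qed.

Definition pts (s : Sc T) : set T := val (val s).

Lemma Sc_pts S x : hausdorff_space T -> converging x S ->
  exists s : Sc T, pts s = S.
Proof.
move=> hT Sx.
have clS : [set F : set T | closed F /\ F !=set0] S.
  by split; [exact: converging_closed Sx|exists x; case: Sx].
pose F : CL T := exist _ S (mem_set clS).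
have ScF : Sc T F.
  exact: converging_nontrivial Sx.
by exists (exist _ F (mem_set ScF)).
Qed.

Lemma pts_converging (s : Sc T) : exists x, converging x (pts s).
Proof. exact/nontrivial_converging/(set_valP s). Qed.

Lemma open_vietoris_base (U : set (set T)) :
  vietoris_index U -> open [set s : Sc T | vietoris_base U (val s)].
Proof.
move=> iU; exists (vietoris_base U) => //.
by exists [set U] => [_ ->//|]; rewrite bigcup_set1.
Qed.

Lemma Sc_open_vietoris (G : set (Sc T)) s : open G -> G s ->
  exists U, [/\ vietoris_index U, vietoris_base U (val s) &
    forall t : Sc T, vietoris_base U (val t) -> G t].
Proof.
move=> [_ [D DI <-] <-] [U DU Us]; exists U; split=> //; first exact: DI.
by move=> t Ut; exists U.
Qed.

End converging_sets.

(** * Sequences in the Alexandroff duplicate *)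

Lemma crowded_nbhs (T : topologicalType) (x : T) (V : set T) :
  crowded T -> nbhs x V -> exists2 w, V w & w <> x.
Proof.
move=> cT Vx; apply: contrapT => nV.
suff : isolated [set: T] x by rewrite cT.
split; first exact/mem_set.
exists V => //; apply/seteqP; split=> [w [Vw _]|_ ->].
  by apply: contrapT => wx; apply: nV; exists w.
by split=> //; exact: nbhs_singleton.
Qed.

Section duplicate.
Context {Y : topologicalType}.
Hypothesis hY : hausdorff_space Y.
Local Notation AD := (alexandroff_duplicate Y).
Implicit Types (y z : Y) (U V : set Y) (F K : set Y).

Lemma open_duplicateE : @open AD = duplicate_open.
Proof. by []. Qed.

Lemma open_duplicate_isolated (F : set Y) : open (F `*` [set true] : set AD).
Proof. by rewrite open_duplicateE => z []. Qed.

Lemma open_duplicate_setX U : open U -> open (U `*` [set: bool] : set AD).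
Proof. by rewrite open_duplicateE => oU z [/= Uz _]; exists U => // p []. Qed.

Lemma duplicate_hausdorff : hausdorff_space AD.
Proof.
have c1 y : closed [set y] by exact/accessible_closed_set1/hausdorff_accessible.
have sep1 y (p : AD) : p <> (y, true) ->
    exists A B : set AD, [/\ A (y, true), B p, open A, open B & A `&` B = set0].
  move=> py; exists ([set y] `*` [set true]), (~` ([set y] `*` [set true])).
  split=> //; first by case: p py => z b py [/= zy bt]; apply: py; rewrite zy bt.
  - exact: open_duplicate_isolated.
  - rewrite open_duplicateE => z _; have [->|zy] := pselect (z = y).
      exists setT; first by split=> //; exact: openT.
      by case=> [w b] [_ /= wb] [/= wy bt]; apply: wb; rewrite wy bt.
    exists (~` [set y]); first by split=> //; exact: closed_openC.
    by move=> [w b] [[/= wy _] _] [].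
  - exact: setICr.
rewrite open_hausdorff => -[x b] [y c] /eqP xy.
suff [A [B [Ax By oA oB AB]]] : exists A B : set AD,
    [/\ A (x, b), B (y, c), open A, open B & A `&` B = set0].
  by exists (A, B) => /=; split=> //; [exact/mem_set|exact/mem_set|exact/eqP].
case: b xy => [xy|]; first by apply: sep1; exact/nesym.
case: c => [xy|xy].
  have [A [B [? ? ? ? ?]]] := sep1 _ _ xy.
  by exists B, A; split=> //; rewrite setIC.
have /eqP xny : x <> y by move=> xy'; apply: xy; rewrite xy'.
move: hY; rewrite open_hausdorff => /(_ _ _ xny)[[A B] /= [Ax By] [oA oB AB0]].
exists (A `*` setT), (B `*` setT); split.
- by split=> //; exact/set_mem.
- by split=> //; exact/set_mem.
- exact: open_duplicate_setX.
- exact: open_duplicate_setX.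
- apply/seteqP; split=> // -[w d] [[/= Aw _] [/= Bw _]].
  by have : (A `&` B) w by []; rewrite (eqP AB0).
Qed.

(** Around [y] itself one uses [U]; around another point of [U], the point [y] has
    to be removed, so points must be closed. *)
Lemma open_duplicate_basic y U : open U -> open (duplicate_basic y U).
Proof.
rewrite open_duplicateE => oU z [[/= Uz _] _].
have [<-|zy] := pselect (z = y); first by exists U.
exists (U `\ y).
  split=> //; rewrite setDE; apply: openI => //; apply: closed_openC.
  exact/accessible_closed_set1/hausdorff_accessible.
by move=> [w b] [[[Uw wy] _] _]; split => //= -[].
Qed.

Lemma duplicate_basic_center y U : open_nbhs y U ->
  duplicate_basic y U (y, false).
Proof. by move=> [_ Uy]; split => // -[]. Qed.

Lemma nbhs_duplicate_basic y U : open_nbhs y U ->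
  nbhs ((y, false) : AD) (duplicate_basic y U).
Proof.
move=> yU; apply: open_nbhs_nbhs; split; last exact: duplicate_basic_center.
by case: yU => oU _; exact: open_duplicate_basic.
Qed.

(** The singleton of an isolated point misses infinitely many points of [S]. *)
Lemma duplicate_limit (p : AD) S : converging p S -> p = (p.1, false).
Proof.
case: p => y [] // [_ _ iS Scvg]; exfalso.
apply: (infinite_setD iS (finite_set1 (y, true))).
by apply: Scvg; rewrite nbhs_duplicate1.
Qed.

Lemma crowded_duplicate_isolated (W : set AD) :
  crowded Y -> open W -> W !=set0 -> exists z, W (z, true).
Proof.
move=> cY oW [[y [|]] Wy]; first by exists y.
have [U yU UW] := oW _ Wy.
have [w Uw wy] := crowded_nbhs cY (open_nbhs_nbhs yU).
by exists w; apply: UW; split=> // -[].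
Qed.

(** For finite [F] and infinite [S], this says that [S] is in the basic Vietoris
    set given by the singletons of the isolated points of [F] and the basic
    neighbourhood of [(y, false)]. *)
Definition block F y U : set (set AD) :=
  [set S | F `*` [set true] `<=` S /\
           S `<=` (F `*` [set true]) `|` duplicate_basic y U].

Lemma blockS F y U V : U `<=` V -> block F y U `<=` block F y V.
Proof.
move=> UV S [FS SF]; split=> // p /SF[|[[Up _] py]]; first by left.
by right; split=> //; split=> //; exact: UV.
Qed.

Lemma open_block F y U : finite_set F -> open_nbhs y U ->
  open [set s : Sc AD | block F y U (pts s)].
Proof.
move=> finF [oU Uy].
pose W := [set [set (f, true) : AD] | f in F] `|` [set duplicate_basic y U].
have iW : vietoris_index W.
  split.
  - by rewrite finite_setU; split; [exact: finite_image|exact: finite_set1].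
  - by exists (duplicate_basic y U); right.
  - move=> _ [[f Ff <-]|->].
      split; last by exists (f, true).
      by move=> z.
    split; first exact: open_duplicate_basic.
    by exists (y, false); exact: duplicate_basic_center.
have /= := open_vietoris_base iW; congr open.
apply/seteqP; split=> s /=.
  move=> [sW Ws]; split.
    move=> [f b] [/= Ff ->]; have [|p [sp pf]] := Ws [set (f, true)].
      by left; exists f.
    by rewrite -[(f, true)](pf : p = _).
  by move=> [z b] /sW[_ [[f Ff <-]|->]]; [move=> [-> ->]; left|right].
move=> [Fs sF]; split.
  move=> p /sF[[Fp p1]|py].
    by exists [set p] => //; left; exists p.1 => //; case: p p1 {Fp} => ? ? /= ->.
  by exists (duplicate_basic y U) => //; right.
move=> _ [[f Ff <-]|->]; first by exists (f, true); split=> //; apply: Fs.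
have [x [_ _ is_ _]] := pts_converging s.
have /infinite_setN0[p [sp nFp]] : infinite_set (pts s `\` F `*` [set true]).
  apply: infinite_setD => //; apply: finite_setX => //; exact: finite_set1.
by exists p; split=> //; case: (sF _ sp).
Qed.

(** A sequence with limit [(y, false)] has all but finitely many points in the
    basic neighbourhood of that limit, so adding and removing finitely many
    isolated points turns it into a member of the block. Removing those of an
    arbitrary [K] is what makes [block_nested] work. *)
Lemma converging_block F K y U S : finite_set F -> finite_set K ->
  open_nbhs y U -> converging ((y, false) : AD) S ->
  let S' := (F `*` [set true]) `|`
            ((S `&` duplicate_basic y U) `\` K `*` [set true]) in
  converging ((y, false) : AD) S' /\ block F y U S'.
Proof.
move=> finF finK yU [Sy cS iS Scvg] S'.
have fin1 A : finite_set A -> finite_set (A `*` [set true]).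
  by move=> ?; apply: finite_setX => //; exact: finite_set1.
split; last first.
  by split=> p; [left|move=> [|[[Sp Up] _]]; [left|right]].
split.
- right; split; last by case.
  by split=> //; exact: duplicate_basic_center.
- apply: (@sub_countable _ _ _ (F `*` [set true] `|` S)).
    by apply: subset_card_le => p [|[[]]]; [left|right].
  rewrite -bigcup2inE; apply: bigcup_countable => //.
  by move=> [|[|]] //= _; exact/finite_set_countable/fin1.
- have : infinite_set (S `\` (S `\` duplicate_basic y U) `\` K `*` [set true]).
    apply: infinite_setD; last exact: fin1.
    by apply: infinite_setD => //; apply: Scvg; exact: nbhs_duplicate_basic.
  apply: sub_infinite_set => p [[Sp nSp] nK]; right; split=> //; split=> //.
  by apply: contrapT => nU; exact: nSp.
- move=> V /Scvg finV; apply: (@sub_finite_set _ _ (F `*` [set true] `|` S `\` V)).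
    by move=> p [[|[[]]] ? ?]; [left|right].
  by rewrite finite_setU; split; first exact: fin1.
Qed.

(** Inclusion of blocks forces the expected relations between the data: it
    suffices to test it on the sequence of [converging_block] which contains no
    point of [F] but those of [F']. *)
Lemma block_nested F y U F' y' U' S : finite_set F -> finite_set F' ->
  open_nbhs y' U' -> converging ((y', false) : AD) S ->
  (forall s : Sc AD, block F' y' U' (pts s) -> block F y U (pts s)) ->
  [/\ F `<=` F', U y' &
      F' `*` [set true] `<=` F `*` [set true] `|` duplicate_basic y U].
Proof.
move=> finF finF' yU' Sy' sub.
have [S'cvg S'F'] := converging_block finF' finF yU' Sy'.
have [s sS'] := Sc_pts duplicate_hausdorff S'cvg.
have [] := sub s; first by rewrite sS'.
rewrite sS' => FS' S'F; split.
- by move=> f Ff; have [|[]//|[_ []]//] := FS' (f, true).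
- by case: S'cvg => /S'F[[]//|[[]]//].
- by move=> p F'p; apply: S'F; left.
Qed.

(** The Vietoris neighbourhood [W] of a sequence [s] of [G] is witnessed by
    isolated points [f w], one in each [w] of [W]; once these are prescribed, a
    set meets every [w] of [W], and only the inclusion in the union of [W]
    remains, which holds if the tail stays in a single [w0] containing the limit
    of [s].
    The extra point [k] outside [K] will make the union of the finite parts
    infinite. *)
Lemma block_refine (G : set (Sc AD)) K : crowded Y -> open G -> G !=set0 ->
  finite_set K ->
  exists F y U, [/\ finite_set F, open_nbhs y U, ~ F `<=` K,
    exists S, converging ((y, false) : AD) S &
    forall s : Sc AD, block F y U (pts s) -> G s].
Proof.
move=> cY oG [s Gs] finK.
have [W [[finW _ oW] [sW Ws] WG]] := Sc_open_vietoris oG Gs.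
have [x xs] := pts_converging s; have xE := duplicate_limit xs.
move: x.1 xE => y xE; rewrite {}xE {x} in xs.
have [/sW[w0 Ww0 w0y] _ _ _] := xs.
have [U yU Uw0] : exists2 U, open_nbhs y U & duplicate_basic y U `<=` w0.
  by have [ow0 _] := oW _ Ww0; exact: ow0.
have /choice[f fW] : forall w : set AD, exists z, W w -> w (z, true).
  move=> w; have [Ww|nWw] := pselect (W w); last by exists y.
  have [ow w_ne] := oW _ Ww.
  by have [z wz] := crowded_duplicate_isolated cY ow w_ne; exists z.
have [k [yk nKk]] :
    exists k, (duplicate_basic y U `\` K `*` [set true]) (k, true).
  apply: crowded_duplicate_isolated => //.
    rewrite setDE; apply: openI.
      by case: yU => oU _; exact: open_duplicate_basic.
    apply: closed_openC; apply: (accessible_finite_set_closed.1 _).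
      exact: (hausdorff_accessible duplicate_hausdorff).
    by apply: finite_setX => //; exact: finite_set1.
  exists (y, false); split; last by case.
  exact: duplicate_basic_center.
exists (f @` W `|` [set k]), y, U; split=> //.
- by rewrite finite_setU; split; [exact: finite_image|exact: finite_set1].
- by move=> /(_ k) Kk; apply: nKk; split=> //; apply: Kk; right.
- by exists (pts s).
move=> t [Ft tF]; apply: WG; split.
  move=> [z b] /tF[[/= [[w Ww <-]|->] ->]|zy].
  - by exists w => //; exact: fW.
  - by exists w0 => //; exact: Uw0.
  - by exists w0 => //; exact: Uw0.
move=> w Ww; exists (f w, true); split; last exact: fW.
by apply: Ft; split=> //; left; exists w.
Qed.

End duplicate.

(** * Boxes in a Sigma-product of metric spaces *)

Lemma finite_sub_increasing (T : Type) (A : set T) (B : (set T)^nat) :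
  (forall m n, (m <= n)%N -> B m `<=` B n) ->
  finite_set A -> A `<=` \bigcup_n B n -> exists n, A `<=` B n.
Proof.
move=> Bmon finA AB.
have /choice[k kB] : forall x, exists n, A x -> B n x.
  move=> x; have [/AB[n _ Bnx]|nAx] := pselect (A x); first by exists n.
  by exists 0%N.
have /finite_seqP[s sE] := finite_image k finA.
exists (\max_(n <- s) n)%N => x Ax; apply: Bmon (kB x Ax).
have : (k @` A) (k x) by exists x.
by rewrite sE => /= ks; exact: leq_bigmax_seq.
Qed.

Section sigma_box.
Context {R : realType} {I : Type} {X : I -> topologicalType}.
Variables (a : forall i, X i) (d : forall i, X i -> X i -> R).
Hypothesis d_metric : forall i, metric_on (@d i).
Hypothesis d_top : forall i, metric_induces_topology (@d i).
Local Notation Z := (set_type (sigma_product a)).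
Implicit Types (x y z : Z) (J : set I) (e : R).

Lemma dist_refl i (u : X i) : d u u = 0.
Proof. by case: (d_metric i) => d0 _ _; apply/d0. Qed.

Lemma distC i (u v : X i) : d u v = d v u.
Proof. by case: (d_metric i). Qed.

Lemma dist_triangle i (v u w : X i) : d u w <= d u v + d v w.
Proof. by case: (d_metric i). Qed.

Lemma dist_gt0 i (u v : X i) : u <> v -> 0 < d u v.
Proof.
move=> uv; have := dist_triangle v u u; rewrite dist_refl (distC v u) => duv.
rewrite lt_neqAle; apply/andP; split; last by lra.
apply/eqP => duv0; apply: uv; case: (d_metric i) => d0 _ _.
by apply/d0; rewrite -duv0.
Qed.

Lemma nbhs_ball i (u : X i) e : 0 < e -> nbhs u [set v | d u v < e].
Proof. by move=> e0; rewrite d_top; exists e. Qed.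

Lemma open_ball i (u : X i) e : open [set v | d u v < e].
Proof.
rewrite openE => v /= uv.
have : nbhs v [set w | d v w < e - d u v] by apply: nbhs_ball; rewrite subr_gt0.
by apply: filterS => w /= vw; have := dist_triangle v u w; lra.
Qed.

Definition box (y : Z) J e : set Z :=
  [set x | forall i, J i -> d (val y i) (val x i) < e].

Lemma box_center y J e : 0 < e -> box y J e y.
Proof. by move=> e0 i _; rewrite dist_refl. Qed.

Lemma box_sub y J J' e e' : J `<=` J' -> e' <= e -> box y J' e' `<=` box y J e.
Proof. by move=> JJ' ee' x xy i /JJ'/xy/lt_le_trans; apply. Qed.

Lemma coord_continuous i : continuous (fun z : Z => val z i : X i).
Proof.
apply/continuousP => A oA; exists [set f : prod_topology X | A (f i)] => //.
rewrite openE => f Af; have /cvg_sup/(_ i) : f --> f by exact: cvg_id.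
by apply; exists [set g : prod_topology X | A (g i)]; split=> //; exists A.
Qed.

Lemma open_box y J e : finite_set J -> open (box y J e).
Proof.
move=> finJ.
have -> : box y J e = \bigcap_(i in (J : set {classic I}))
    ((fun z => val z i : X i) @^-1` [set v | d (val y i) v < e]).
  by [].
have /finite_fsetP[J' ->] : finite_set (J : set {classic I}) by [].
rewrite openE => x xy; apply: filter_bigI => i iJ'.
apply: open_nbhs_nbhs; split; last exact: xy.
by apply: open_comp; [move=> z _; exact: coord_continuous|exact: open_ball].
Qed.

Lemma open_nbhs_box y J e : finite_set J -> 0 < e -> open_nbhs y (box y J e).
Proof. by move=> finJ e0; split; [exact: open_box|exact: box_center]. Qed.

(** Every neighbourhood in the product contains a box because the filter of
    boxes around a point converges to it coordinatewise. *)
Lemma nbhs_sub_box z (A : set Z) : nbhs z A ->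
  exists J e, [/\ finite_set J, 0 < e & box z J e `<=` A].
Proof.
rewrite nbhsE => -[_ [[B oB <-] Bz] BA].
pose Bx (p : set I * R) : set (prod_topology X) :=
  [set f | forall i, p.1 i -> d (val z i) (f i) < p.2].
pose D := [set p : set I * R | finite_set p.1 /\ 0 < p.2].
have FF : Filter (filter_from D Bx).
  apply: filter_from_filter; first by exists (set0, 1); split=> //; exact: ltr01.
  move=> [J e] [J' e'] [/= fJ e0] [/= fJ' e'0].
  exists (J `|` J', Num.min e e').
    by split=> /=; [rewrite finite_setU|rewrite lt_min e0].
  by move=> f ff; split=> i Ji; have := ff i; rewrite lt_min => /(_ _)/andP[];
    [left| |right|].
have : filter_from D Bx --> (val z : prod_topology X).
  apply/cvg_sup => i W; rewrite nbhsE => -[_ [[V oV <-] Vz] VW].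
  have : nbhs (val z i) V by apply: open_nbhs_nbhs; split.
  rewrite d_top => -[e e0 eV]; exists ([set i], e).
    by split=> //; exact: finite_set1.
  by move=> f ff; apply: VW; apply: eV; exact: ff.
move=> /(_ B)[|[J e] [fJ e0] JB]; first by apply: open_nbhs_nbhs; split.
by exists J, e; split=> // x xz; apply: BA; apply: JB.
Qed.

Lemma sigma_hausdorff : hausdorff_space Z.
Proof.
rewrite open_hausdorff => x y /eqP xy.
have [i xyi] : exists i, val x i <> val y i.
  apply: contrapT => /forallNP nxy; apply/xy/val_inj.
  by apply: functional_extensionality_dep => i; apply: contrapT; exact: nxy.
have dxy := dist_gt0 xyi; have f1 := finite_set1 i.
have d20 : 0 < d (val x i) (val y i) / 2 by rewrite divr_gt0.
exists (box x [set i] (d (val x i) (val y i) / 2),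
        box y [set i] (d (val x i) (val y i) / 2)) => /=.
  by split; apply/mem_set; exact: box_center.
split; [exact: open_box|exact: open_box|].
apply/eqP/seteqP; split=> // z [/(_ i erefl) xz /(_ i erefl) yz].
have := dist_triangle (val z i) (val x i) (val y i).
by rewrite (distC (val z i)); lra.
Qed.

End sigma_box.

(** * Fusion of a decreasing sequence of blocks *)

Section fusion.
Context {R : realType} {I : Type} {X : I -> topologicalType}.
Variables (a : forall i, X i) (d : forall i, X i -> X i -> R).
Hypothesis d_metric : forall i, metric_on (@d i).
Hypothesis d_top : forall i, metric_induces_topology (@d i).
Hypothesis d_complete : forall i, complete_metric (@d i).
Local Notation Z := (set_type (sigma_product a)).
Local Notation AD := (alexandroff_duplicate Z).
Implicit Types (x y z : Z) (J : set I) (e : R).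

Record stage := Stage {
  stage_pts : set Z;
  stage_center : Z;
  stage_coords : set I;
  stage_radius : R }.

(** The factor [c] is [1] or [2]: stages are nested for [c = 1], so that limits of
    centres only fall in the closed boxes, which the boxes for [c = 2] contain. *)
Definition stage_box (p : stage) (c : R) : set Z :=
  box d (stage_center p) (stage_coords p) (c * stage_radius p).

Definition stage_block (p : stage) (c : R) : set (Sc AD) :=
  [set s | block (stage_pts p) (stage_center p) (stage_box p c) (pts s)].

Definition stage_valid (p : stage) : Prop :=
  [/\ finite_set (stage_pts p), finite_set (stage_coords p),
      0 < stage_radius p &
      exists S, converging ((stage_center p, false) : AD) S].

Let hZ : hausdorff_space Z := sigma_hausdorff d_metric d_top.

Lemma stage_open_nbhs p c : stage_valid p -> 0 < c ->
  open_nbhs (stage_center p) (stage_box p c).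
Proof.
by move=> [_ fJ e0 _] c0; apply: open_nbhs_box => //; exact: mulr_gt0.
Qed.

Lemma stage_block_neq0 p c : stage_valid p -> 0 < c -> stage_block p c !=set0.
Proof.
move=> vp c0; have [fF _ _ [S Sy]] := vp.
have [S'cvg S'F] :=
  converging_block hZ fF (finite_set0 _) (stage_open_nbhs vp c0) Sy.
have [s sE] := Sc_pts (duplicate_hausdorff hZ) S'cvg.
by exists s; rewrite /stage_block /= sE.
Qed.

Lemma open_stage_block p c : stage_valid p -> 0 < c -> open (stage_block p c).
Proof.
move=> vp c0; have [fF _ _ _] := vp.
exact: (open_block hZ fF (stage_open_nbhs vp c0)).
Qed.

(** Here [g z] enumerates the support of [z], the set of coordinates where [z]
    differs from [a]. At step [n], the coordinates controlled by the new stage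
    include those of index at most [n] in the support of any of its points: these
    are finitely many, and every coordinate of the support is reached at some
    later step. *)
Lemma stage_extension (g : Z -> I -> nat) (G : set (Sc AD)) K J n :
  crowded Z ->
  (forall z, {in [set i | val z i <> a i] &, injective (g z)}) ->
  open G -> G !=set0 -> finite_set K -> finite_set J ->
  exists p, [/\ stage_valid p,
    [/\ ~ stage_pts p `<=` K, J `<=` stage_coords p &
        stage_radius p <= n.+1%:R^-1],
    forall f i, stage_pts p f -> val f i <> a i -> (g f i <= n)%N ->
      stage_coords p i &
    stage_block p 2 `<=` G].
Proof.
move=> cZ ginj oG G0 finK finJ.
have [F [y [U [finF [oU Uy] FK Sy FG]]]] := block_refine hZ cZ oG G0 finK.
have [J0 [e0 [finJ0 e0_gt0 J0U]]] :=
  nbhs_sub_box d_top (open_nbhs_nbhs (conj oU Uy)).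
pose Jg := \bigcup_(f in F) [set i | val f i <> a i /\ (g f i <= n)%N].
exists (Stage F y (J `|` J0 `|` Jg) (Num.min (e0 / 2) n.+1%:R^-1)).
split=> /=.
- split=> //=; last by rewrite lt_min divr_gt0 //= invr_gt0.
  rewrite !finite_setU; split=> //; apply: bigcup_finite => // f Ff.
  have /eq_finite_set <- : g f @` [set i | val f i <> a i /\ (g f i <= n)%N] #=
      [set i | val f i <> a i /\ (g f i <= n)%N].
    apply: inj_card_eq => i j /set_mem[fi _] /set_mem[fj _].
    by apply: ginj; exact/mem_set.
  apply: (sub_finite_set _ (finite_II n.+1)).
  by move=> _ [i [_ gi] <-].
- split=> //; first by move=> i Ji; left; left.
  by rewrite ge_min lexx orbT.
- by move=> f i Ff fi gi; right; exists f.
- move=> s sb; apply: FG; apply: blockS sb => z zy; apply: J0U.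
  apply: box_sub zy; first by move=> i; left; right.
  by rewrite mulrC -ler_pdivlMr // ge_min lexx.
Qed.

Section limit.
Variables (g : Z -> I -> nat) (p : nat -> stage).
Hypothesis p_valid : forall n, stage_valid (p n).
Hypothesis p_radius : forall n, stage_radius (p n) <= n.+1%:R^-1.
Hypothesis p_coords : forall n, stage_coords (p n) `<=` stage_coords (p n.+1).
Hypothesis p_pts : forall n, ~ stage_pts (p n.+1) `<=` stage_pts (p n).
Hypothesis p_supp : forall n f i, stage_pts (p n) f -> val f i <> a i ->
  (g f i <= n)%N -> stage_coords (p n) i.
Hypothesis p_block : forall n, stage_block (p n.+1) 2 `<=` stage_block (p n) 1.

Local Notation F n := (stage_pts (p n)).
Local Notation y n := (stage_center (p n)).
Local Notation J n := (stage_coords (p n)).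
Local Notation e n := (stage_radius (p n)).

Lemma radius_gt0 n : 0 < e n.
Proof. by case: (p_valid n). Qed.

Lemma stage_box12 n : stage_box (p n) 1 `<=` stage_box (p n) 2.
Proof. by apply: box_sub => //; rewrite ler_pM2r ?radius_gt0 //; lra. Qed.

Lemma coords_mono m n : (m <= n)%N -> J m `<=` J n.
Proof.
elim: n => [|n IH]; first by rewrite leqn0 => /eqP->.
rewrite leq_eqVlt => /orP[/eqP->//|]; rewrite ltnS => /IH.
by move/subset_trans; apply; exact: p_coords.
Qed.

Lemma stage_block_sub m n : (m < n)%N ->
  stage_block (p n) 2 `<=` stage_block (p m) 1.
Proof.
elim: n => // n IH; rewrite ltnS leq_eqVlt => /orP[/eqP->|/IH sub].
  exact: p_block.
by move=> s /p_block/(blockS (@stage_box12 n))/sub.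
Qed.

Lemma stage_nested m n : (m < n)%N ->
  [/\ F m `<=` F n, stage_box (p m) 1 (y n) &
    F n `*` [set true] `<=`
    F m `*` [set true] `|` duplicate_basic (y m) (stage_box (p m) 1)].
Proof.
move=> mn; have [[fm _ _ _] [fn _ _ [S Sn]]] := (p_valid m, p_valid n).
apply: (block_nested hZ fm fn (stage_open_nbhs (p_valid n) (ltr0n R 2)) Sn).
exact: stage_block_sub.
Qed.

Lemma pts_mono m n : (m <= n)%N -> F m `<=` F n.
Proof.
by rewrite leq_eqVlt => /orP[/eqP->//|/stage_nested[]].
Qed.

Lemma center_dist m n i : (m <= n)%N -> J m i ->
  d (val (y m) i) (val (y n) i) < e m.
Proof.
rewrite leq_eqVlt => /orP[/eqP->|/stage_nested[_ + _]].
  by move=> _; rewrite dist_refl // radius_gt0.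
by move=> + Jm => /(_ _ Jm); rewrite mul1r.
Qed.

Lemma radius_small (eps : R) : 0 < eps ->
  exists N, forall n, (N <= n)%N -> e n < eps.
Proof.
move=> eps0; have [N _ NP] := near_infty_natSinv_lt (PosNum eps0).
by exists N => n /NP; apply: le_lt_trans.
Qed.

(** Once controlled, a coordinate of the centres is a Cauchy sequence. *)
Lemma center_cvg i : exists l : X i,
  (forall n, J n i -> d (val (y n) i) l <= e n) /\
  ((forall n, ~ J n i) -> l = a i).
Proof.
have [[n0 Jn0]|nJ] := pselect (exists n, J n i); last first.
  exists (a i); split=> // n Jn; exfalso; apply: nJ; by exists n.
have [] := d_complete (u := fun n => val (y n) i).
  move=> eps eps0; have eps2 : 0 < eps / 2 by rewrite divr_gt0.
  have [N NP] := radius_small eps2.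
  exists (maxn N n0) => m n; rewrite !geq_max => /andP[Nm n0m] /andP[Nn n0n].
  pose M := maxn N n0.
  have JM : J M i by apply: coords_mono Jn0; exact: leq_maxr.
  have eM : e M < eps / 2 by apply: NP; exact: leq_maxl.
  have ym : d (val (y M) i) (val (y m) i) < e M.
    by apply: center_dist => //; rewrite geq_max Nm.
  have yn : d (val (y M) i) (val (y n) i) < e M.
    by apply: center_dist => //; rewrite geq_max Nn.
  have := dist_triangle d_metric (val (y M) i) (val (y m) i) (val (y n) i).
  rewrite (distC d_metric (val (y m) i) (val (y M) i)); lra.
move=> l yl; exists l; split; last by move=> /(_ n0).
move=> n Jn; apply/ler_addgt0Pr => eps eps0.
have [N _ NP] := yl _ (nbhs_ball d_top l eps0).
have /= := NP _ (leq_maxl N n); have := center_dist (leq_maxr N n) Jn.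
have := dist_triangle d_metric (val (y (maxn N n)) i) (val (y n) i) l.
by rewrite (distC d_metric l); lra.
Qed.

Lemma countable_coords : countable (\bigcup_n J n).
Proof.
apply: bigcup_countable => // n _; apply: finite_set_countable.
by case: (p_valid n).
Qed.

(** The limit point belongs to the Sigma-product because only countably many
    coordinates are ever controlled. *)
Lemma center_limit : exists l : Z,
  (forall n i, J n i -> d (val (y n) i) (val l i) <= e n) /\
  (forall i, (forall n, ~ J n i) -> val l i = a i).
Proof.
pose l : prod_topology X := fun i => projT1 (cid (center_cvg i)).
have lP i : (forall n, J n i -> d (val (y n) i) (l i) <= e n) /\
  ((forall n, ~ J n i) -> l i = a i) := projT2 (cid (center_cvg i)).
have Zl : sigma_product a l.
  apply: sub_countable countable_coords; apply: subset_card_le => i li.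
  apply: contrapT => nJ; apply: li; apply: (lP i).2 => n Jn.
  by apply: nJ; exists n.
exists (exist _ l (mem_set Zl)); split=> [n i|i]; first exact: (lP i).1.
exact: (lP i).2.
Qed.

(** A point of [F m] that is not in [F n] is close to [l] on the coordinates
    controlled at stage [n], and equal to [l] on those which are never controlled.
    Nothing is claimed on a coordinate controlled only later, hence the
    hypothesis on [i]. *)
Lemma pts_in_box (l : Z) m n (f : Z) :
  (forall n i, J n i -> d (val (y n) i) (val l i) <= e n) ->
  (forall i, (forall n, ~ J n i) -> val l i = a i) ->
  F m f -> ~ F n f -> forall i, (forall k, J k i -> J n i) ->
  d (val l i) (val f i) < 2 * e n.
Proof.
move=> ly la Fm nFn i Ji.
have nm : (n < m)%N.
  by rewrite ltnNge; apply/negP => /pts_mono/(_ _ Fm).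
have [Jn|nJn] := pselect (J n i).
  have [_ _ /(_ (f, true))[]//] := stage_nested nm; first by case.
  move=> [[/= /(_ _ Jn) yf _] _]; rewrite mul1r in yf.
  have := dist_triangle d_metric (val (y n) i) (val l i) (val f i).
  by have := ly _ _ Jn; rewrite (distC d_metric (val l i) (val (y n) i)); lra.
have nJ k : ~ J k i by move=> /Ji.
have -> : val f i = a i.
  apply: contrapT => fi; apply: (nJ (maxn m (g f i))).
  by apply: p_supp fi _; [apply: pts_mono Fm; exact: leq_maxl|exact: leq_maxr].
by rewrite la // dist_refl // mulr_gt0 // radius_gt0.
Qed.

(** Given a box around [l] on finitely many coordinates, some stage [N] already
    controls those of its coordinates that are ever controlled; the points of
    later stages outside [F N] are then in that box. *)
Lemma stage_limit : exists s : Sc AD, forall n, stage_block (p n) 2 s.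
Proof.
have [l [ly la]] := center_limit.
pose S : set AD := (l, false) |` (\bigcup_n F n) `*` [set true].
have fin1 A : finite_set A -> finite_set (A `*` [set true] : set AD).
  by move=> ?; apply: finite_setX => //; exact: finite_set1.
have finF n : finite_set (F n) by case: (p_valid n).
have Scvg : converging ((l, false) : AD) S.
  split.
  - by left.
  - have cF : countable ((\bigcup_n F n) `*` [set true]).
      apply: countableX; last exact: countable1.
      by apply: bigcup_countable => // n _; exact: finite_set_countable.
    rewrite /S -bigcup2inE; apply: bigcup_countable => //.
    by move=> [|[|]] //= _; exact: countable1.
  - move=> finS.
    have : finite_set (\bigcup_n F n).
      apply: (sub_finite_set _ (finite_image fst finS)) => f Ff.
      by exists (f, true) => //; right.
    move=> /(finite_sub_increasing pts_mono)[//|n Fn].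
    by apply: (p_pts (n := n)) => f Ff; apply: Fn; exists n.+1.
  move=> V; rewrite (nbhs_duplicate0 _ (hausdorff_accessible hZ)).
  move=> [U /open_nbhs_nbhs/(nbhs_sub_box d_top)[K [eps [finK eps0 KU]]] UV].
  have eps2 : 0 < eps / 2 by rewrite divr_gt0.
  have [N1 N1P] := radius_small eps2.
  have [N2 N2P] : exists n, K `&` \bigcup_n J n `<=` J n.
    apply: finite_sub_increasing coords_mono _ _; first exact: finite_setIl.
    by move=> i [].
  pose N := maxn N1 N2.
  apply: (@sub_finite_set _ _ ((F N `|` [set l]) `*` [set true])); last first.
    by apply: fin1; rewrite finite_setU; split; [exact: finF|exact: finite_set1].
  (* Apart from the points of [F N], only the isolated copy of [l] can fail to be
     in [V], as basic neighbourhoods of [(l, false)] omit it. *)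
  move=> [f b] [[->|[[/= m _ Fm] ->]] nV].
    exfalso; apply: nV; apply: UV; split; last by case.
    by split=> //; apply: KU; exact: box_center.
  split=> //=; apply: contrapT => /not_orP[nFN fl].
  apply: nV; apply: UV; split; last by case.
  split=> //; apply: KU => i Ki.
  apply: (@lt_trans _ _ (2 * e N)); last first.
    have := N1P N (leq_maxl _ _); lra.
  apply: pts_in_box ly la Fm nFN _ _ => k Jk.
  by apply: coords_mono (leq_maxr N1 N2) _ (N2P _ _); split=> //; exists k.
have [s sE] := Sc_pts (duplicate_hausdorff hZ) Scvg.
exists s => n; rewrite /stage_block /= sE; split.
  by move=> [f b] [/= Ff ->]; right; split=> //; exists n.
move=> [f b] [[-> ->]|[[/= m _ Fm] ->]].
  right; split; last by case.
  split=> // i /ly/le_lt_trans; apply.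
  by rewrite ltr_pMl ?radius_gt0 // ltr1n.
have [mn|nm] := leqP m n; first by left; split=> //; exact: pts_mono Fm.
have [_ _ /(_ (f, true))[]//] := stage_nested nm; first by left.
by move=> [[/= fb _] fy]; right; split=> //; split=> //; exact: stage_box12.
Qed.

End limit.

Lemma sigma_duplicate_baire : crowded Z -> baire_space (Sc AD).
Proof.
move=> cZ D oD O O0 oO.
have /choice[g ginj] : forall z, exists g : I -> nat,
    {in [set i | val z i <> a i] &, injective g}.
  by move=> z; apply/countable_injP; exact: (set_valP z).
have [p0 [vp0 [_ _ rp0] sp0 bp0]] :=
  stage_extension 0 cZ ginj oO O0 (finite_set0 _) (finite_set0 _).
pose next n p q := [/\ stage_valid q,
  [/\ ~ stage_pts q `<=` stage_pts p, stage_coords p `<=` stage_coords q &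
      stage_radius q <= n.+2%:R^-1],
  forall f i, stage_pts q f -> val f i <> a i -> (g f i <= n.+1)%N ->
    stage_coords q i &
  stage_block q 2 `<=` stage_block p 1 `&` D n].
have /choice[h hP] : forall np : nat * stage, exists q,
    stage_valid np.2 -> next np.1 np.2 q.
  move=> [n p] /=; have [vp|] := pselect (stage_valid p); last by exists p.
  have [[fF fJ _ _] [oDn dDn]] := (vp, oD n).
  have [q qP] := stage_extension n.+1 cZ ginj
    (openI (open_stage_block vp ltr01) oDn)
    (dDn _ (stage_block_neq0 vp ltr01) (open_stage_block vp ltr01)) fF fJ.
  by exists q.
pose p := fix p n := if n is m.+1 then h (m, p m) else p0.
have vp n : stage_valid (p n).
  by elim: n => // n IH; case: (hP (n, p n) IH).
have pP n : next n (p n) (p n.+1) := hP (n, p n) (vp n).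
have [|||||s sP] := @stage_limit g p vp.
- by case=> [//|n]; case: (pP n) => _ [].
- by move=> n; case: (pP n) => _ [].
- by move=> n; case: (pP n) => _ [].
- by case=> [//|n]; case: (pP n).
- by move=> n t; case: (pP n) => _ _ _ /[apply] -[].
exists s; split; first exact/bp0/(sP 0%N).
by move=> n _; case: (pP n) => _ _ _ /(_ _ (sP n.+1))[].
Qed.

End fusion.

Theorem theorem3p13 (R : realType) (I : Type) (X : I -> topologicalType)
    (a : forall i : I, X i) :
  (forall i : I, completely_metrizable R (X i)) ->
  crowded (sigma_product a) ->
  baire_space (Sc (alexandroff_duplicate (sigma_product a))).
Proof.
move=> /(_ _)/cid-/all_sig[d dP].
apply: (@sigma_duplicate_baire R I X a d) => i; by case: (dP i).
Qed.
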